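(* Let $\mathcal{S}$ be an Archimedean semiring of the commutative unital $\mathbb{R}$-algebra $\mathcal{A}$ and let $\mathcal{C}\subseteq\mathcal{A}$ be an $\mathcal{S}$-module. For any $a\in\mathcal{A}$, the following are equivalent: (i) $\varphi(a)>0$ for all $\varphi\in\mathrm{char}(\mathcal{A},\mathcal{C})$. (ii) There exists $\epsilon\in(0,\infty)$ such that $a\in\epsilon 1+\mathcal{C}$.
   Context: Let $\mathcal{A}$ be a commutative unital $\mathbb{R}$-algebra with unit $1$. A convex cone in $\mathcal{A}$ is a non-empty subset $\mathcal{C}$ with $\mathcal{C}+\mathcal{C}\subseteq\mathcal{C}$ and $\lambda\mathcal{C}\subseteq\mathcal{C}$ for all real $\lambda\ge 0$. A semiring of $\mathcal{A}$ is a convex cone $\mathcal{S}$ with $1\in\mathcal{S}$ and $\mathcal{S}\cdot\mathcal{S}\subseteq\mathcal{S}$. An $\mathcal{S}$-module is a convex cone $\mathcal{C}$ with $1\in\mathcal{C}$ and $ac\in\mathcal{C}$ for all $a\in\mathcal{S}$, $c\in\mathcal{C}$. A convex cone $\mathcal{C}$ with $1\in\mathcal{C}$ is Archimedean if for every $a\in\mathcal{A}$ there is $\lambda\in(0,\infty)$ with $\lambda 1-a\in\mathcal{C}$ and $\lambda 1+a\in\mathcal{C}$. $\mathrm{char}(\mathcal{A})$ is the set of unital algebra homomorphisms $\varphi:\mathcal{A}\to\mathbb{R}$, and $\mathrm{char}(\mathcal{A},\mathcal{C}):=\{\varphi\in\mathrm{char}(\mathcal{A}) : \varphi(c)\ge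 0 \text{ for all } c\in\mathcal{C}\}$. *)

(* Defs.v *)
From HB Require Import structures.
From mathcomp Require Import all_boot all_order all_algebra.
From mathcomp Require Import classical_sets reals.

Set Implicit Arguments.
Unset Strict Implicit.
Unset Printing Implicit Defensive.

Import Order.TTheory GRing.Theory Num.Theory.

Local Open Scope classical_set_scope.
Local Open Scope ring_scope.

(* Commutative unital R-algebras.  Unlike MathComp's [comAlgType], which builds
   in [1 != 0], this also admits the zero algebra; [alg_scale] is the operation
   behind [*:] once the [lmodType] instance below is declared. *)
Record comPzAlgType (R : pzRingType) := ComPzAlgType {
  alg_ring : comPzRingType;
  alg_scale : R -> alg_ring -> alg_ring;
  alg_scaleA : forall k l x, alg_scale k (alg_scale l x) = alg_scale (k * l) x;
  alg_scale1 : left_id 1 alg_scale;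
  alg_scaleDr : right_distributive alg_scale +%R;
  alg_scaleDl : forall x, {morph alg_scale^~ x : k l / k + l};
  alg_scaleAl : forall k x y, alg_scale k (x * y) = alg_scale k x * y
}.

Definition alg_sort (R : pzRingType) (A : comPzAlgType R) : Type := alg_ring A.
Coercion alg_sort : comPzAlgType >-> Sortclass.

HB.instance Definition _ (R : pzRingType) (A : comPzAlgType R) :=
  GRing.ComPzRing.copy (alg_sort A) (alg_ring A).
HB.instance Definition _ (R : pzRingType) (A : comPzAlgType R) :=
  GRing.Zmodule_isLmodule.Build R (alg_sort A)
    (@alg_scaleA R A) (@alg_scale1 R A) (@alg_scaleDr R A) (@alg_scaleDl R A).

Lemma pz_scalerAl (R : pzRingType) (A : comPzAlgType R) (k : R) (x y : A) :
  k *: (x * y) = (k *: x) * y.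
Proof. exact: alg_scaleAl. Qed.

Definition comPzAlg_of_comAlg (R : pzRingType) (A : comAlgType R) :
    comPzAlgType R :=
  ComPzAlgType (@scalerA R A) (@scale1r R A) (@scalerDr R A)
    (fun x k l => scalerDl x k l) (@scalerAl R A).

Definition convex_cone (R : realType) (A : comPzAlgType R) (C : set A) : Prop :=
  [/\ C !=set0,
      forall x y, C x -> C y -> C (x + y)
    & forall (l : R) x, 0 <= l -> C x -> C (l *: x)].

Definition cone_semiring (R : realType) (A : comPzAlgType R) (S : set A) : Prop :=
  [/\ convex_cone S, S 1 & forall x y, S x -> S y -> S (x * y)].

Definition cone_module (R : realType) (A : comPzAlgType R) (S C : set A) : Prop :=
  [/\ convex_cone C, C 1 & forall a c, S a -> C c -> C (a * c)].

Definition archimedean_cone (R : realType) (A : comPzAlgType R) (C : set A) : Prop :=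
  [/\ convex_cone C, C 1
    & forall a : A, exists l : R,
        [/\ 0 < l, C (l *: (1 : A) - a) & C (l *: (1 : A) + a)]].

Definition characters (R : realType) (A : comPzAlgType R) : set (A -> R) :=
  [set phi : A -> R | scalar phi /\ monoid_morphism phi].

Definition nonneg_characters (R : realType) (A : comPzAlgType R) (C : set A) :
    set (A -> R) :=
  [set phi | characters phi /\ forall c, C c -> 0 <= phi c].

(* Main.v *)
Require Import Defs.
From HB Require Import structures.
From mathcomp Require Import all_boot all_order all_algebra.
From mathcomp Require Import boolp classical_sets reals ring lra.

Set Implicit Arguments.
Unset Strict Implicit.
Unset Printing Implicit Defensive.

Import Order.TTheory GRing.Theory Num.Theory.

Local Open Scope classical_set_scope.
Local Open Scope ring_scope.

(** Only the implication from (i) to (ii) needs work.  Call an S-module proper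
    when it does not contain -1.

    The heart of the matter is that every proper S-module is contained in the
    nonnegativity set of a character ([exists_nonneg_character]).  By Zorn it
    lies in a maximal proper S-module M.  Maximality makes M total, that is, x
    or -x lies in M for every x ([maximal_total]), and closed under x + e -> x
    as e tends to 0+ ([maximal_closed]).  Since M contains the Archimedean
    semiring S, every x then differs by exactly one real number r, the supremum
    of the t with x - t in M, from an element of the support M :&: -M
    ([supp_translate]).  This support is an ideal, because every element of the
    algebra is a difference of an element of S and a scalar; hence A / supp M is
    the real line, and the quotient map is a character whose nonnegativity set
    contains M.

    Let now a be positive under all characters that are nonnegative on C.  No
    such character is nonnegative at -a, so the S-module C - S a is not proper:
    s a = 1 + c with s in S and c in C.  To divide by s, choose a real N > 0 with
    N - s in S.  If a + r is in C for some real r >= 0, then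
      N (a + r - 1/N) = (N - s)(a + r) + (s a - 1) + r s
    is in C too ([descent_step]).  As a + n/N is in C for large integers n, going
    down in steps of 1/N leads to a - 1/N in C ([descent]). *)

(** * Scalars as elements of the algebra *)

(** Scalars are turned into ring elements through a ring morphism, so that
    identities mixing scaling and multiplication become ring identities. *)
Definition alg_const (R : pzRingType) (A : comPzAlgType R) (k : R) : A :=
  k *: (1 : A).

Lemma scale_constE (R : pzRingType) (A : comPzAlgType R) (k : R) (x : A) :
  k *: x = alg_const A k * x.
Proof. by rewrite /alg_const -pz_scalerAl mul1r. Qed.

Lemma alg_const_is_zmod_morphism (R : pzRingType) (A : comPzAlgType R) :
  zmod_morphism (alg_const A).
Proof. by move=> k l; rewrite /alg_const scalerBl. Qed.

Lemma alg_const_is_monoid_morphism (R : pzRingType) (A : comPzAlgType R) :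
  monoid_morphism (alg_const A).
Proof.
split=> [|k l]; first by rewrite /alg_const scale1r.
by rewrite -scale_constE /alg_const scalerA.
Qed.

HB.instance Definition _ (R : pzRingType) (A : comPzAlgType R) :=
  GRing.isZmodMorphism.Build R A (alg_const A)
    (@alg_const_is_zmod_morphism R A).
HB.instance Definition _ (R : pzRingType) (A : comPzAlgType R) :=
  GRing.isMonoidMorphism.Build R A (alg_const A)
    (@alg_const_is_monoid_morphism R A).

Section PositivityOverSemirings.
Context (R : realType) (A : comPzAlgType R) (S : set A).
Hypotheses (semiringS : cone_semiring S) (archS : archimedean_cone S).
Implicit Types (C M : set A) (a c s x y : A) (k r e : R).

Local Notation "k %:A" := (alg_const A k) : ring_scope.

Let semiring0 : S 0.
Proof.
by case: semiringS => -[[s Ss] _ Sz] _ _; rewrite -(scale0r s); apply: Sz.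
Qed.

(** * Modules over an Archimedean semiring *)

Lemma archimedean_bounds x :
  exists l, [/\ 0 < l, S (l%:A - x) & S (l%:A + x)].
Proof. by case: archS => _ _; apply. Qed.

Section Modules.
Variables (M : set A).
Hypothesis modM : cone_module S M.

Lemma cone_moduleD x y : M x -> M y -> M (x + y).
Proof. by case: modM => -[_ + _] _ _; apply. Qed.

Lemma cone_moduleM s x : S s -> M x -> M (s * x).
Proof. by case: modM => _ _; apply. Qed.

Lemma cone_moduleZ k x : 0 <= k -> M x -> M (k%:A * x).
Proof. by case: modM => -[_ _ + ] _ _; rewrite -scale_constE; apply. Qed.

Lemma cone_module1 : M 1. Proof. by case: modM. Qed.

Lemma cone_module_const k : 0 <= k -> M (k%:A).
Proof.
by move=> k0; rewrite -[_%:A]mulr1; apply: cone_moduleZ cone_module1.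
Qed.

Lemma cone_module0 : M 0.
Proof. by rewrite -(rmorph0 (alg_const A)); apply: cone_module_const. Qed.

Lemma semiring_sub_module s : S s -> M s.
Proof. by move=> Ss; rewrite -[s]mulr1; apply: cone_moduleM cone_module1. Qed.

Lemma proper_const_ge0 k : ~ M (-1) -> M (k%:A) -> 0 <= k.
Proof.
move=> proper Mk; rewrite leNgt; apply/negP => k0; apply: proper.
have -> : -1 = (- k)^-1%:A * k%:A.
  by rewrite -rmorphM invrN mulNr mulVf ?rmorphN1 // lt_eqF.
by apply: cone_moduleZ => //; rewrite invr_ge0 oppr_ge0 ltW.
Qed.

(** The support M :&: -M absorbs S; it absorbs all of A because each y is the
    difference of l + y in S and a scalar l. *)
Lemma supp_ideal x y : M x -> M (- x) -> M (y * x).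
Proof.
move=> Mx MNx; have [l [l0 _ Sly]] := archimedean_bounds y.
have -> : y * x = (l%:A + y) * x + l%:A * (- x) by ring.
by apply: cone_moduleD (cone_moduleM _ _) (cone_moduleZ (ltW l0) _).
Qed.

Definition adjoin x : set A :=
  [set y | exists m s, [/\ M m, S s & y = m + s * x]].

Lemma adjoin_module x : cone_module S (adjoin x).
Proof.
have [[_ SD SZ] _ SM] := semiringS.
split; first split.
- by exists 0, 0, 0; split=> //; [exact: cone_module0|ring].
- move=> _ _ [m [s [Mm Ss ->]]] [m' [s' [Mm' Ss' ->]]].
  exists (m + m'), (s + s'); split; [exact: cone_moduleD|exact: SD|ring].
- move=> k _ k0 [m [s [Mm Ss ->]]]; exists (k *: m), (k *: s).
  rewrite !scale_constE; split; [exact: cone_moduleZ| |ring].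
  by rewrite -scale_constE; apply: SZ.
- by exists 1, 0; split=> //; [exact: cone_module1|ring].
- move=> t _ St [m [s [Mm Ss ->]]]; exists (t * m), (t * s).
  split; [exact: cone_moduleM|exact: SM|ring].
Qed.

Lemma sub_adjoin x : M `<=` adjoin x.
Proof. by move=> m Mm; exists m, 0; split=> //; ring. Qed.

Lemma adjoin_self x : adjoin x x.
Proof.
have [_ S1 _] := semiringS.
by exists 0, 1; split=> //; [exact: cone_module0|ring].
Qed.

Definition closure_along1 : set A := [set x | forall e, 0 < e -> M (x + e%:A)].

Lemma sub_closure_along1 : M `<=` closure_along1.
Proof.
by move=> x Mx e e0; apply: cone_moduleD => //; apply/cone_module_const/ltW.
Qed.

(** Stability under s in S: if l > 0 and l - s is in S, then
    s x + e = s (x + e / l) + (e / l) (l - s), and both terms are in M. *)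
Lemma closure_along1_module : cone_module S closure_along1.
Proof.
have mul s x : S s -> closure_along1 x -> closure_along1 (s * x).
  move=> Ss clx e e0; have [l [l0 Sls _]] := archimedean_bounds s.
  have el0 : 0 < e / l by rewrite divr_gt0.
  have -> : s * x + e%:A = s * (x + (e / l)%:A) + (e / l)%:A * (l%:A - s).
    by rewrite -{1}(divfK (lt0r_neq0 l0) e); ring.
  apply: cone_moduleD; first exact: cone_moduleM (clx _ _).
  by apply: cone_moduleZ; [exact: ltW|exact: semiring_sub_module].
split; first split.
- by exists 1; apply: sub_closure_along1 cone_module1.
- move=> x y clx cly e e0.
  have -> : x + y + e%:A = (x + (e / 2)%:A) + (y + (e / 2)%:A).
    by rewrite {1}[e]splitr; ring.
  by apply: cone_moduleD; [apply: clx|apply: cly]; rewrite divr_gt0.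
- move=> k x k0 clx; rewrite scale_constE; apply: mul clx.
  have [_ S1 _] := semiringS; have [[_ _ SZ] _ _] := semiringS.
  exact: SZ.
- exact: sub_closure_along1 cone_module1.
- by move=> s x; apply: mul.
Qed.

End Modules.

(** * Maximal proper modules *)

Definition proper_module M := cone_module S M /\ ~ M (-1).

Definition maximal_module M :=
  proper_module M /\ forall M', proper_module M' -> M `<=` M' -> M' `<=` M.

Lemma exists_maximal_module M :
  proper_module M -> exists2 M', maximal_module M' & M `<=` M'.
Proof.
move=> [modM M1].
(* The empty set is admitted so that the union of the empty chain is allowed. *)
pose P M' := M' = set0 \/ proper_module M' /\ M `<=` M'.
have [F FP Ftot|M' [PM' maxM']] := @Zorn_bigcup A P.
  have [[M0 FM0 [m0 M0m0]]|Fempty] :=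
      pselect (exists2 M0, F M0 & M0 !=set0); last first.
    left; apply/seteqP; split=> // x [M' FM' M'x].
    by apply: Fempty; exists M' => //; exists x.
  have FPx M' x : F M' -> M' x -> proper_module M' /\ M `<=` M'.
    by move=> /FP [->|].
  have [_ sub0] := FPx _ _ FM0 M0m0.
  right; split; last by move=> x Mx; exists M0 => //; apply: sub0.
  split; last by move=> [M' FM' M'1]; have [[_]] := FPx _ _ FM' M'1.
  split; first split.
  - by exists m0, M0.
  - move=> x y [M1' FM1 M1x] [M2 FM2 M2y].
    have [sub|sub] := Ftot _ _ FM1 FM2.
      have [[mod2 _] _] := FPx _ _ FM2 M2y.
      by exists M2 => //; apply: cone_moduleD mod2 _ _ (sub _ M1x) M2y.
    have [[mod1 _] _] := FPx _ _ FM1 M1x.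
    by exists M1' => //; apply: cone_moduleD mod1 _ _ M1x (sub _ M2y).
  - move=> k x k0 [M' FM' M'x]; have [[mod' _] _] := FPx _ _ FM' M'x.
    by exists M' => //; rewrite scale_constE; apply: cone_moduleZ.
  - by exists M0 => //; apply: sub0; exact: cone_module1.
  - move=> s x Ss [M' FM' M'x]; have [[mod' _] _] := FPx _ _ FM' M'x.
    by exists M' => //; apply: cone_moduleM.
case: PM' => [M'0|[properM' sub]].
  exfalso; apply: (maxM' M); last by right; split=> //; split.
  rewrite M'0; split=> // /(_ 1); apply; exact: cone_module1.
exists M' => //; split=> // M2 properM2 sub2 x M2x.
have [//|nM'x] := pselect (M' x); exfalso.
apply: (maxM' M2); last by right; split=> // y /sub /sub2.
by split=> // /(_ x M2x).
Qed.

Section MaximalModules.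
Variable M : set A.
Hypothesis maxM : maximal_module M.

Let modM : cone_module S M. Proof. by case: maxM => -[]. Qed.
Let properM : ~ M (-1). Proof. by case: maxM => -[]. Qed.

Lemma maximal_adjoin x : ~ M x -> adjoin M x (-1).
Proof.
move=> nMx; apply: contrapT => proper; apply: nMx.
have [_ /(_ (adjoin M x))] := maxM; apply.
- by split=> //; apply: adjoin_module.
- exact: sub_adjoin.
- exact: adjoin_self.
Qed.

(** If neither x nor -x is in M then -1 = m + s x = m' - s' x with s, s' in S.
    Eliminating x gives -(s + s') = s' m + s m' in M, so s lies in the support
    of M.  Then so does s x, whence -1 = m + s x is in M. *)
Lemma maximal_total x : M x \/ M (- x).
Proof.
apply: contrapT => /not_orP[/maximal_adjoin[m [s [Mm Ss E]]]].
move=> /maximal_adjoin[m' [s' [Mm' Ss' E']]]; apply: properM; rewrite E.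
have MNss' : M (- (s + s')).
  have -> : - (s + s') = s' * m + s * m'.
    have -> : m = -1 - s * x by rewrite E; ring.
    by have -> : m' = -1 - s' * (- x) by [rewrite E'; ring]; ring.
  by apply: cone_moduleD => //; apply: cone_moduleM.
have MNs : M (- s).
  have -> : - s = - (s + s') + s' by ring.
  exact: cone_moduleD (semiring_sub_module modM Ss').
apply: cone_moduleD => //; rewrite mulrC.
by apply: supp_ideal => //; apply: semiring_sub_module.
Qed.

Lemma maximal_closed : closure_along1 M `<=` M.
Proof.
have [_] := maxM; apply; last exact: sub_closure_along1.
split; first exact: closure_along1_module.
move=> /(_ (1 / 2)); have -> : -1 + (1 / 2)%:A = (- (1 / 2))%:A.
  by rewrite -(rmorphN1 (alg_const A)) -rmorphD; congr alg_const; lra.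
move=> /(_ ltac:(lra)) /(proper_const_ge0 modM properM); lra.
Qed.

Lemma supp_translate x : exists r, M (x - r%:A) /\ M (- (x - r%:A)).
Proof.
have [l [l0 Slx Slx']] := archimedean_bounds x.
pose E := [set t : R | M (x - t%:A)].
have supE : has_sup E.
  split.
    exists (- l); apply: semiring_sub_module => //.
    by have -> : x - (- l)%:A = l%:A + x by ring.
  exists l => t Et; rewrite -subr_ge0; apply: (proper_const_ge0 modM properM).
  have -> : (l - t)%:A = (l%:A - x) + (x - t%:A) by ring.
  by apply: cone_moduleD => //; apply: semiring_sub_module.
exists (sup E); split; apply: maximal_closed => e e0.
  have [t Et lt_t] := sup_adherent e0 supE.
  have -> : x - (sup E)%:A + e%:A = (x - t%:A) + (t - (sup E - e))%:A by ring.
  by apply: cone_moduleD => //; apply: cone_module_const => //; lra.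
have -> : - (x - (sup E)%:A) + e%:A = - (x - (sup E + e)%:A) by ring.
have [Ee|//] := maximal_total (x - (sup E + e)%:A).
have [_ ubE] := supE; have := ub_le_sup ubE Ee; lra.
Qed.

Lemma supp_translate_unique x r r' :
    M (x - r%:A) -> M (- (x - r%:A)) -> M (x - r'%:A) -> M (- (x - r'%:A)) ->
  r = r'.
Proof.
move=> Mr MNr Mr' MNr'; apply/eqP; rewrite eq_le -subr_ge0 -[r' <= r]subr_ge0.
apply/andP; split; apply: (proper_const_ge0 modM properM).
  have -> : (r' - r)%:A = - (x - r'%:A) + (x - r%:A) by ring.
  exact: cone_moduleD.
have -> : (r - r')%:A = (x - r'%:A) + - (x - r%:A) by ring.
exact: cone_moduleD.
Qed.

Lemma maximal_character : nonneg_characters M !=set0.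
Proof.
pose phi x := projT1 (cid (supp_translate x)).
have phiP x : M (x - (phi x)%:A) /\ M (- (x - (phi x)%:A)).
  exact: projT2 (cid (supp_translate x)).
have phi_eq x r : M (x - r%:A) -> M (- (x - r%:A)) -> phi x = r.
  by have [Mx MNx] := phiP x; apply: supp_translate_unique.
exists phi; split; last first.
  move=> c Mc; apply: (proper_const_ge0 modM properM); have [_ MNc] := phiP c.
  have -> : (phi c)%:A = c + - (c - (phi c)%:A) by ring.
  exact: cone_moduleD.
split; last split.
- move=> k x y; have [Mx MNx] := phiP x; have [My MNy] := phiP y.
  have E : k *: x + y - (k * phi x + phi y)%:A =
      k%:A * (x - (phi x)%:A) + (y - (phi y)%:A).
    by rewrite scale_constE; ring.
  apply: phi_eq; rewrite E.
    by apply: cone_moduleD => //; apply: supp_ideal.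
  rewrite opprD -mulrN; apply: cone_moduleD => //; apply: supp_ideal => //.
  by rewrite opprK.
- by apply: phi_eq; rewrite rmorph1 subrr ?oppr0; apply: cone_module0.
- move=> x y; have [Mx MNx] := phiP x; have [My MNy] := phiP y.
  have E : x * y - (phi x * phi y)%:A =
      y * (x - (phi x)%:A) + (phi x)%:A * (y - (phi y)%:A) by ring.
  apply: phi_eq; rewrite E.
    by apply: cone_moduleD => //; apply: supp_ideal.
  rewrite opprD -!mulrN; apply: cone_moduleD => //; apply: supp_ideal => //;
    by rewrite opprK.
Qed.

End MaximalModules.

Lemma exists_nonneg_character M : proper_module M -> nonneg_characters M !=set0.
Proof.
move=> /exists_maximal_module[M' /maximal_character[phi [charphi phi0]] sub].
by exists phi; split=> // c /sub /phi0.
Qed.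

(** * Dividing by an element of the semiring *)

Lemma descent_step C a s c r k :
    cone_module S C -> S s -> C c -> s * a = 1 + c -> 0 < k -> S (k%:A - s) ->
  0 <= r -> C (a + r%:A) -> C (a + (r - k^-1)%:A).
Proof.
move=> modC Ss Cc sa k0 Sks r0 Car.
have -> : a + (r - k^-1)%:A =
    k^-1%:A * ((k%:A - s) * (a + r%:A) + c + r%:A * s).
  have -> : c = s * a - 1 by rewrite sa; ring.
  transitivity ((k^-1 * k)%:A * (a + r%:A) - k^-1%:A); last ring.
  by rewrite mulVf ?lt0r_neq0 //; ring.
apply: cone_moduleZ => //; first by rewrite invr_ge0 ltW.
apply: cone_moduleD => //; last first.
  by apply: cone_moduleZ => //; apply: semiring_sub_module.
by apply: cone_moduleD => //; apply: cone_moduleM.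
Qed.

Lemma descent C a s c :
    cone_module S C -> S s -> C c -> s * a = 1 + c ->
  exists2 e, 0 < e & C (a - e%:A).
Proof.
move=> modC Ss Cc sa.
have [k [k0 Sks _]] := archimedean_bounds s.
have step n : C (a + (n%:R / k)%:A) -> C (a - k^-1%:A).
  elim: n => [|n IHn] Can.
    rewrite mul0r in Can.
    have := descent_step modC Ss Cc sa k0 Sks (lexx 0) Can.
    by rewrite sub0r rmorphN.
  apply: IHn; have -> : n%:R / k = n.+1%:R / k - k^-1 by rewrite -natr1; ring.
  by apply: (descent_step modC Ss Cc sa k0 Sks _ Can); rewrite divr_ge0 // ltW.
exists k^-1; first by rewrite invr_gt0.
have [l [l0 _ Sla]] := archimedean_bounds a.
apply: (step (Num.truncn (l * k)).+1).
set n := _.+1; have ltn : l < n%:R / k by rewrite ltr_pdivlMr // truncnS_gt.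
have -> : a + (n%:R / k)%:A = (l%:A + a) + (n%:R / k - l)%:A by ring.
apply: cone_moduleD => //; first exact: semiring_sub_module.
by apply: cone_module_const => //; lra.
Qed.

End PositivityOverSemirings.

Theorem theorem3p3 (R : realType) (A : comPzAlgType R) (S C : set A)
    (semiringS : cone_semiring S) (archS : archimedean_cone S)
    (moduleC : cone_module S C) (a : A) :
  (forall phi : A -> R, nonneg_characters C phi -> 0 < phi a) <->
  (exists2 eps : R, 0 < eps & exists2 c : A, C c & a = eps *: (1 : A) + c).
Proof.
split=> [pos|[eps eps0 [c Cc ->]] phi [[phi_lin [phi1 _]] phi_ge0]]; last first.
  by rewrite phi_lin phi1 mulr1 ltr_pwDl ?phi_ge0.
(* A character that is nonnegative on C - S a would be nonpositive at a. *)
have [s [c [Ss Cc sa]]] : exists s c, [/\ S s, C c & s * a = 1 + c].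
  have [[c [s [Cc Ss E]]]|proper] := pselect (adjoin S C (- a) (-1)).
    by exists s, c; split=> //; rewrite -[1]opprK E; ring.
  have [|phi [charphi phi_ge0]] :=
      exists_nonneg_character semiringS archS (M := adjoin S C (- a)).
    by split=> //; apply: adjoin_module.
  have : 0 < phi a.
    by apply: pos; split=> // c Cc; apply: phi_ge0; apply: sub_adjoin.
  have : 0 <= phi (- a) by apply: phi_ge0; apply: adjoin_self.
  have [phi_lin _] := charphi.
  have phi0 : phi 0 = 0.
    by have := phi_lin 1 0 0; rewrite scale1r addr0 mul1r; lra.
  have -> : phi (- a) = - phi a.
    have := phi_lin (-1) a 0; rewrite scaleN1r !addr0 phi0 addr0 => ->.
    by rewrite mulN1r.
  by move=> ? ?; exfalso; lra.
have [e e0 Cae] := descent archS moduleC Ss Cc sa.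
by exists e => //; exists (a - alg_const A e) => //; rewrite /alg_const; ring.
Qed.
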